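(* Suppose that for every $i\in\mathcal N$ the control function $f_i:\mathbb R\to\mathbb R$ is nonincreasing over $\mathbb R$, and strictly decreasing and differentiable on $(-\infty,-\delta_i/2)\cup(\delta_i/2,\infty)$. Then there exists a unique Nash equilibrium for the voltage control game $\mathcal G=\{\mathcal N,(\Omega_i)_{i\in\mathcal N},(h_i)_{i\in\mathcal N}\}$. Moreover, a point $q^a\in\Omega$ is a Nash equilibrium of $\mathcal G$ if and only if it is the unique optimum of $$\min_{q\in\Omega}\ W(q),\qquad W(q)=\sum_{i\in\mathcal N}\Big(C_i(q_i)+\tfrac12 X_{ii}q_i^2\Big)+\tfrac12 q^{\top}Xq+q^{\top}\Delta\tilde v .$$
   Context: Network: a rooted tree with node set $\mathcal N\cup\{0\}$, $\mathcal N=\{1,\dots,n\}$, root $0$, and set of lines (edges) $\mathcal L$; each line $(h,k)\in\mathcal L$ has reactance $x_{hk}>0$. $\mathcal L_i\subseteq\mathcal L$ is the set of lines on the unique path from $0$ to $i$. The reactance matrix $X\in\mathbb R^{n\times n}$ is $X_{ij}=\sum_{(h,k)\in\mathcal L_i\cap\mathcal L_j}x_{hk}$; it is symmetric positive definite. $\Delta\tilde v\in\mathbb R^n$ is a given constant vector. For each $i\in\mathcal N$: $\delta_i\ge 0$; $f_i:\mathbb R\to\mathbb R$ is a control function with $f_i(u)=0$ for $u\in[-\delta_i/2,\delta_i/2]$; $\Omega_i=\{q_i: q_i^{\min}\le q_i\le q_i^{\max}\}$ is a nonempty closed interval; $\Omega=\times_{i\in\mathcal N}\Omega_i$. The cost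 function of node $i$ is $C_i(q_i)=-\int_0^{q_i}f_i^{-1}(q)\,dq$, where $f_i^{-1}$ is the inverse of $f_i$ (the value assigned at $q=0$ is immaterial to the integral; it is implicit that $f_i^{-1}$ is defined at all nonzero points between $0$ and points of $\Omega_i$, so that $C_i$ is well defined on $\Omega_i$). Voltage control game $\mathcal G$: the players are the nodes $i\in\mathcal N$, the strategy space of $i$ is $\Omega_i$, and the cost function of $i$ is $h_i(q)=C_i(q_i)+q_i\big(\sum_{j\in\mathcal N}X_{ij}q_j+\Delta\tilde v_i\big)$, also written $h_i(q_i,q_{-i})$ with $q_{-i}$ the entries of $q$ other than $q_i$. A vector $q^a\in\Omega$ is a Nash equilibrium if for all $i\in\mathcal N$, $h_i(q_i^a,q_{-i}^a)\le h_i(q_i,q_{-i}^a)$ for all $q_i\in\Omega_i$. *)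

(* Defs.v *)
From HB Require Import structures.
From mathcomp Require Import all_boot all_order all_algebra.
From mathcomp Require Import all_classical all_reals all_analysis.

Set Implicit Arguments.
Unset Strict Implicit.
Unset Printing Implicit Defensive.

Import Order.TTheory GRing.Theory Num.Theory.
Import numFieldNormedType.Exports.

Local Open Scope ring_scope.

(* A line is an unordered pair of nodes, encoded as a two-element set. *)
Section Trees.
Variable V : finType.
Implicit Types (L : {set {set V}}) (r u : V) (p : seq V).

Definition adj L : rel V := fun h k => (h != k) && ([set h; k]%SET \in L).

Definition is_tree L : Prop :=
  [/\ forall l, l \in L -> #|l| = 2%N,
      forall u v, connect (adj L) u v
    & forall c, (2 < size c)%N -> uniq c -> ~~ cycle (adj L) c].

(* The path visits u, then the successive entries of p. *)
Definition lines_of_path u p : seq {set V} :=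
  pairmap (fun h k => [set h; k]%SET) u p.

Definition simple_path L r u p : Prop :=
  [/\ path (adj L) r p, last r p = u & uniq (r :: p)].

(* In a tree the simple path from r to u exists and is unique. *)
Definition path_lines L r u : {set {set V}} :=
  [set l in L | `[< exists p, simple_path L r u p /\ l \in lines_of_path r p >]]%SET.

End Trees.

(* The nodes are 'I_n.+1 with root ord0; the non-root node of index i : 'I_n is
   lift ord0 i. *)
Definition root_lines (n : nat) (L : {set {set 'I_n.+1}}) (i : 'I_n) :
    {set {set 'I_n.+1}} :=
  path_lines L ord0 (lift ord0 i).

Definition reactance_mx (R : realType) (n : nat) (L : {set {set 'I_n.+1}})
    (x : {set 'I_n.+1} -> R) : 'M[R]_n :=
  \matrix_(i, j) \sum_(l in (root_lines L i :&: root_lines L j)%SET) x l.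

(* Some preimage of y under f, and 0 if there is none: the inverse of f at every
   value attained exactly once. *)
Definition inv_fun (R : realType) (f : R -> R) (y : R) : R :=
  xget 0 [set u | f u = y]%classic.

Definition oriented_integral (R : realType) (g : R -> R) (a b : R) : R :=
  if a <= b then \int[lebesgue_measure]_(y in `[a, b]%classic) g y
  else - \int[lebesgue_measure]_(y in `[b, a]%classic) g y.

Definition node_cost (R : realType) (f : R -> R) (q : R) : R :=
  - oriented_integral (inv_fun f) 0 q.

Definition strategy_interval (R : realType) (n : nat) (qmin qmax : 'I_n -> R)
    (i : 'I_n) : set R :=
  `[qmin i, qmax i]%classic.

Section Games.
Context {R : realType} {n : nat}.
Implicit Types (Omega : 'I_n -> set R) (h : 'I_n -> 'cV[R]_n -> R).

Definition profiles Omega : set 'cV[R]_n :=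
  [set q | forall i, Omega i (q i 0)]%classic.

Definition deviate (q : 'cV[R]_n) (i : 'I_n) (t : R) : 'cV[R]_n :=
  \col_j (if j == i then t else q j 0).

Definition nash_equilibrium Omega h (q : 'cV[R]_n) : Prop :=
  profiles Omega q /\
  forall i t, Omega i t -> h i q <= h i (deviate q i t).

Definition is_minimizer (S : set 'cV[R]_n) (W : 'cV[R]_n -> R) (q : 'cV[R]_n) :
    Prop :=
  S q /\ forall q', S q' -> W q <= W q'.

Definition unique_minimizer (S : set 'cV[R]_n) (W : 'cV[R]_n -> R)
    (q : 'cV[R]_n) : Prop :=
  is_minimizer S W q /\ forall q', is_minimizer S W q' -> q' = q.

End Games.

Section VoltageControl.
Context {R : realType} {n : nat}.
Variables (X : 'M[R]_n) (dv : 'cV[R]_n) (f : 'I_n -> R -> R).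

Definition game_cost (i : 'I_n) (q : 'cV[R]_n) : R :=
  node_cost (f i) (q i 0) + q i 0 * (\sum_j X i j * q j 0 + dv i 0).

Definition potential (q : 'cV[R]_n) : R :=
  \sum_i (node_cost (f i) (q i 0) + 2^-1 * X i i * q i 0 ^+ 2)
  + 2^-1 * (q^T *m X *m q) 0 0 + (q^T *m dv) 0 0.

End VoltageControl.

(* Main.v *)
Require Import Defs.
From HB Require Import structures.
From mathcomp Require Import all_boot all_order all_algebra.
From mathcomp Require Import all_classical all_reals all_analysis.
From mathcomp Require Import ring lra.
Import Order.TTheory GRing.Theory Num.Theory.
Import numFieldNormedType.Exports.
Local Open Scope ring_scope.

Set Implicit Arguments.
Unset Strict Implicit.
Unset Printing Implicit Defensive.

(** The game is an exact potential game: since [X] is symmetric, a deviation of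
one node changes its own cost and [W] by the same amount
([potential_deviate]).  So a minimizer of [W] over the box is an equilibrium,
and a minimizer exists because [W] is continuous and the box compact
([potential_minimizer_exists]).

The converse rests on convexity.  The inverse of a nonincreasing control
function is nonincreasing, so its primitive is concave and each cost [C_i] is
convex, with no smoothness beyond a bounded subgradient
([node_cost_extension]).  Because the nonsmooth part of [W] is separable, the
best-response condition of node [i] at an equilibrium [q], applied to points
[q_i + t (p_i - q_i)] with [t] going to [0], yields the first-order inequality
<<
  C_i(p_i) - C_i(q_i) + (p_i - q_i) (sum_j X_ij q_j + dv_i + X_ii q_i) >= 0
>>
([nash_first_order]).  With [d := p - q], the difference [W p - W q] is exactly
the sum of these left-hand sides plus [(sum_i X_ii d_i^2 + d^T X d) / 2]
([potentialB]).  The tree enters only here: [d^T X d] is the sum over the lines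
[l] of [x_l] times the square of the sum of the [d_i] for the nodes [i] behind
[l], hence nonnegative, and [X_ii > 0] because the path from the root to [i] has
at least one line.  Thus [W p >= W q + sum_i X_ii d_i^2 / 2] for every profile
[p] ([nash_potential_growth]): an equilibrium is the unique minimizer of [W],
which also gives uniqueness of the equilibrium. *)

(** * Primitives of nonincreasing functions *)

Section NonincreasingIntegrand.
Context {R : realType}.
Local Notation mu := (@lebesgue_measure R).
Implicit Types (g : R -> R) (a b : R).

Lemma nonincreasing_integrable g a b :
  {homo g : u v / u <= v >-> v <= u} ->
  mu.-integrable `[a, b]%classic (EFin \o g).
Proof.
move=> g_ni; apply: measurable_bounded_integrable => //.
- by rewrite /= lebesgue_measure_itv/=; case: ifP => // _; rewrite -EFinB ltry.
- exact: measurable_realfun.nonincreasing_measurable.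
exists (`|g a| + `|g b|); split; first by rewrite num_real.
move=> M ltM u /=; rewrite in_itv/= => /andP[au ub].
have := g_ni _ _ au; have := g_ni _ _ ub => h1 h2; apply: le_trans (ltW ltM).
rewrite ler_norml; have := ler_norm (g a); have := ler_norm (- g b).
rewrite normrN; have := normr_ge0 (g a); have := normr_ge0 (g b).
by move=> *; apply/andP; split; lra.
Qed.

Lemma Rintegral_segment_cst a b (c : R) :
  a <= b -> \int[mu]_(y in `[a, b]%classic) c = c * (b - a).
Proof.
move=> ab; rewrite Rintegral_cst// /= lebesgue_measure_itv/= lte_fin.
by case: ltgtP ab => // -> _; rewrite subrr mulr0.
Qed.

Lemma Rintegral_segment_split g a b c :
  mu.-integrable `[a, c]%classic (EFin \o g) -> a <= b <= c ->
  \int[mu]_(y in `[a, c]%classic) g y =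
  \int[mu]_(y in `[a, b]%classic) g y + \int[mu]_(y in `[b, c]%classic) g y.
Proof.
move=> ig /andP[ab bc].
rewrite -[X in _ + X]Rintegral_itv_obnd_cbnd; last first.
  apply: integrableS ig => // y /=; rewrite !in_itv/= => /andP[by_ ->].
  by rewrite (le_trans ab (ltW by_)).
rewrite -(@Rintegral_itvB _ g (BLeft a) (BRight c) b) ?bnd_simp//.
by rewrite addrC subrK.
Qed.

Lemma oriented_integralB g a b :
  {homo g : u v / u <= v >-> v <= u} -> a <= b ->
  oriented_integral g 0 b - oriented_integral g 0 a =
  \int[mu]_(y in `[a, b]%classic) g y.
Proof.
move=> g_ni ab; rewrite /oriented_integral.
have ig := fun u v => @nonincreasing_integrable g u v g_ni.
have [a0|a0] := leP 0 a.
- rewrite (le_trans a0 ab) (@Rintegral_segment_split g 0 a b) ?a0 ?ab//.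
  by rewrite addrC addKr.
- have [b0|b0] := leP 0 b; rewrite opprK.
    by rewrite (@Rintegral_segment_split g a 0 b) ?(ltW a0) ?b0// addrC.
  rewrite (@Rintegral_segment_split g a b 0) ?ab ?(ltW b0)//.
  by rewrite addrCA addNr addr0.
Qed.

(** On a segment [g] lies between its end values; the two orders of [a] and [b]
give the same inequality, so [g a] is a supergradient of the primitive at [a]. *)
Lemma oriented_integral_concave g a b :
  {homo g : u v / u <= v >-> v <= u} ->
  oriented_integral g 0 b <= oriented_integral g 0 a + g a * (b - a).
Proof.
move=> g_ni.
have ic c u v : mu.-integrable `[u, v]%classic (EFin \o fun=> c : R).
  exact: nonincreasing_integrable.
have ig := fun u v => @nonincreasing_integrable g u v g_ni.
have [ab|/ltW ba] := leP a b.
- rewrite -lerBlDl oriented_integralB// -Rintegral_segment_cst//.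
  by apply: le_Rintegral => // y; rewrite /= in_itv/= => /andP[/g_ni].
- rewrite -[b - a]opprB mulrN lerBrDr -lerBrDl oriented_integralB//.
  rewrite -Rintegral_segment_cst//.
  by apply: le_Rintegral => // y; rewrite /= in_itv/= => /andP[_ /g_ni].
Qed.

Lemma eq_oriented_integral g g' b (J : set R) :
  is_interval J -> J 0 -> J b -> (forall y, J y -> g y = g' y) ->
  oriented_integral g 0 b = oriented_integral g' 0 b.
Proof.
move=> iJ J0 Jb gg'; rewrite /oriented_integral.
case: ifP => _; [|congr (- _)]; apply: eq_Rintegral => y;
  rewrite inE/= in_itv/= => yJ; apply: gg'.
- exact: iJ J0 Jb _ yJ.
- exact: iJ Jb J0 _ yJ.
Qed.

End NonincreasingIntegrand.

(** * Convexity and continuity of the node costs *)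

Section NodeCost.
Context {R : realType}.
Implicit Types (f g c : R -> R).

(** Only attainment matters, whichever preimage is selected: of two distinct
values, the larger one has all its preimages to the left of those of the
smaller one.  In particular the arbitrary choice at the value [0], where the
preimage is a whole interval, does not spoil monotonicity. *)
Lemma inv_fun_nonincreasing f (y z : R) :
  {homo f : u v / u <= v >-> v <= u} ->
  (exists u, f u = y) -> (exists u, f u = z) ->
  y <= z -> inv_fun f z <= inv_fun f y.
Proof.
move=> f_ni [u fu] [v fv]; rewrite le_eqVlt => /predU1P[->//|yz].
have fK w t : f t = w -> f (inv_fun f w) = w.
  by move=> ft; apply: (@xgetPex _ 0 [set s | f s = w]%classic); exists t.
have [//|/ltW/f_ni] := leP (inv_fun f z) (inv_fun f y).
by rewrite (fK _ _ fu) (fK _ _ fv) leNgt yz.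
Qed.

(** The subgradient inequalities at [a] and at [b] bound [c b - c a] on both
sides, so [c] is Lipschitz with constant [M]. *)
Lemma bounded_subgradient_continuous c (s : R -> R) (M : R) :
  (forall a b, c a + s a * (b - a) <= c b) -> (forall a, `|s a| <= M) ->
  continuous c.
Proof.
move=> cs sM a.
have M0 : 0 <= M by rewrite (le_trans _ (sM 0)).
have lip b : `|c b - c a| <= M * `|b - a|.
  have sle u v : s u * (v - u) >= - (M * `|v - u|).
    by rewrite lerNl -mulrN (le_trans (ler_norm _))// normrM normrN ler_wpM2r.
  have := cs a b; have := cs b a; have := sle a b; have := sle b a.
  by rewrite (distrC a b) ler_norml => *; apply/andP; split; lra.
apply/cvgrPdist_le => e e0; near=> b.
rewrite distrC (le_trans (lip b))//.
have : `|a - b| <= e / (M + 1).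
  near: b; apply: (@cvgr_dist_le _ _ _ (nbhs a) _ id a cvg_id).
  by rewrite divr_gt0 // ltr_wpDl.
rewrite distrC ler_pdivlMr ?ltr_wpDl// => h; apply: le_trans h.
by rewrite mulrC ler_wpM2l// lerDl.
Unshelve. all: by end_near. Qed.

(** The inverse is controlled only on the values attained by [f], which include
the hull of [0] and [[lo, hi]].  Clamping its argument to this hull gives a
bounded function that is nonincreasing on all of [R], without changing the
integrals that define the cost on [[lo, hi]]; the resulting [c] is then convex and
continuous on the whole line, and no boundary point needs special care. *)
Lemma node_cost_extension f (lo hi : R) :
  lo <= hi -> {homo f : u v / u <= v >-> v <= u} -> f 0 = 0 ->
  (forall q y, lo <= q <= hi -> y != 0 ->
     Num.min 0 q <= y <= Num.max 0 q -> exists u, f u = y) ->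
  exists c s : R -> R,
    [/\ {in `[lo, hi], node_cost f =1 c},
        forall a b, c a + s a * (b - a) <= c b & continuous c].
Proof.
move=> lohi f_ni f0 f_inv.
(* The hull of 0 and of the segment from lo to hi. *)
pose lo0 := Num.min 0 lo; pose hi0 := Num.max 0 hi.
have [l0 h0] : lo0 <= 0 /\ 0 <= hi0 by rewrite ge_min le_max !lexx.
have [ll hh] : lo0 <= lo /\ hi <= hi0 by rewrite ge_min le_max !lexx !orbT.
have att y : lo0 <= y <= hi0 -> exists u, f u = y.
  move=> /andP[loy yhi]; have [->|y0] := eqVneq y 0; first by exists 0.
  have [yle|/ltW yge] := leP y 0.
  - by apply: (f_inv lo) => //; [rewrite lexx|rewrite loy le_max yle].
  - by apply: (f_inv hi) => //; [rewrite lohi/=|rewrite yhi ge_min yge].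
clearbody lo0 hi0; pose clamp (y : R) := Num.max lo0 (Num.min hi0 y).
have clampP y : lo0 <= clamp y <= hi0.
  by rewrite /clamp le_max lexx/= ge_max (le_trans l0 h0)/= ge_min lexx.
have clamp_id y : lo0 <= y <= hi0 -> clamp y = y.
  by move=> /andP[ly yh]; rewrite /clamp (min_idPr yh) (max_idPr ly).
have clamp_homo y z : y <= z -> clamp y <= clamp z.
  move=> yz; rewrite /clamp ge_max !le_max lexx/=.
  by rewrite le_min !ge_min lexx yz !orbT.
pose g y := inv_fun f (clamp y).
have g_ni : {homo g : u v / u <= v >-> v <= u}.
  move=> y z yz; apply: inv_fun_nonincreasing => //; try exact: att.
  exact: clamp_homo.
have cs a b : - oriented_integral g 0 a + - g a * (b - a) <=
              - oriented_integral g 0 b.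
  by rewrite mulNr -opprD lerN2; exact: oriented_integral_concave.
exists (fun q => - oriented_integral g 0 q), (fun q => - g q); split => //.
- move=> q; rewrite in_itv/= => /andP[loq qhi]; congr (- _).
  apply: (@eq_oriented_integral _ _ _ _ `[lo0, hi0]%classic).
  + exact: interval_is_interval.
  + by rewrite /= in_itv/= l0.
  + by rewrite /= in_itv/= (le_trans ll loq) (le_trans qhi hh).
  + by move=> y; rewrite /= in_itv/= /g => /clamp_id ->.
apply: (@bounded_subgradient_continuous _ (fun q => - g q)
  (`|inv_fun f lo0| + `|inv_fun f hi0|) cs) => a.
have /andP[la ah] := clampP a.
have : inv_fun f hi0 <= g a <= inv_fun f lo0.
  by rewrite !inv_fun_nonincreasing//; apply: att;
    rewrite ?lexx ?la ?ah ?(le_trans l0 h0).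
move=> /andP[]; rewrite normrN ler_norml.
have := ler_norm (inv_fun f lo0).
have := ler_norm (- inv_fun f hi0); rewrite normrN.
have := normr_ge0 (inv_fun f lo0); have := normr_ge0 (inv_fun f hi0).
by move=> *; apply/andP; split; lra.
Qed.

End NodeCost.

(** * The reactance matrix of a tree *)

Section Reactance.
Context {R : realType} {n : nat}.
Variables (L : {set {set 'I_n.+1}}) (x : {set 'I_n.+1} -> R).
Hypothesis x_gt0 : forall l, l \in L -> 0 < x l.

Lemma reactance_mx_sym : (reactance_mx L x)^T = reactance_mx L x.
Proof. by apply/matrixP => i j; rewrite !mxE finset.setIC. Qed.

Lemma root_lines_sub (i : 'I_n) l : l \in root_lines L i -> l \in L.
Proof. by rewrite inE => /andP[]. Qed.

(** The matrix is the sum over the lines [l] of [x l] times the rank-one matrix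
[a a^T], where [a] is the indicator of the nodes whose root path uses [l]; the
quadratic form is therefore a sum of weighted squares. *)
Lemma reactance_mx_psd (d : 'cV[R]_n) :
  0 <= (d^T *m reactance_mx L x *m d) 0 0.
Proof.
pose w l i : R := (l \in root_lines L i)%:R * d i 0.
have -> : (d^T *m reactance_mx L x *m d) 0 0 =
    \sum_(l in L) x l * (\sum_i w l i) ^+ 2.
  rewrite mxE.
  under eq_bigr => j _ do rewrite mxE mulr_suml.
  under [RHS]eq_bigr => l _ do rewrite expr2 mulrA mulr_sumr.
  rewrite [RHS]exchange_big/=; apply: eq_bigr => j _.
  under [RHS]eq_bigr => l _ do rewrite mulr_sumr mulr_suml.
  rewrite [RHS]exchange_big/=; apply: eq_bigr => i _.
  rewrite !mxE mulr_sumr mulr_suml [LHS]big_mkcond [RHS]big_mkcond/=.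
  apply: eq_bigr => l _; rewrite inE /w.
  have [/root_lines_sub ->|_] /= := boolP (l \in root_lines L i).
    by case: (l \in root_lines L j) => /=; ring.
  by case: ifP => // _; ring.
by apply: sumr_ge0 => l lL; rewrite mulr_ge0 ?sqr_ge0// ltW ?x_gt0.
Qed.

Lemma root_lines_neq0 (i : 'I_n) :
  connect (adj L) ord0 (lift ord0 i) -> exists l, l \in root_lines L i.
Proof.
move=> /connectP[p0 /shortenP[[|k p] pth up _ lst]]; first by [].
have /andP[/andP[_ kL] _] := pth.
exists [set ord0; k]%SET; rewrite inE kL; apply/asboolP; exists (k :: p).
by split; [split|rewrite inE eqxx].
Qed.

Lemma reactance_mx_diag_gt0 (i : 'I_n) :
  connect (adj L) ord0 (lift ord0 i) -> 0 < reactance_mx L x i i.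
Proof.
move=> /root_lines_neq0[l li]; rewrite mxE finset.setIid (bigD1 l)//=.
rewrite ltr_pwDl//; first exact/x_gt0/root_lines_sub/li.
by apply: sumr_ge0 => k /andP[/root_lines_sub/x_gt0/ltW].
Qed.

End Reactance.

(** * The potential of the game and its first-order behaviour *)

Section PotentialGame.
Context {R : realType} {n : nat}.
Variables (X : 'M[R]_n) (dv : 'cV[R]_n) (f : 'I_n -> R -> R).
Implicit Types (p q : 'cV[R]_n) (i : 'I_n) (t : R).

(** The derivative of [h_i - C_i] with respect to the strategy of node [i], which
is also that of [W - C_i]. *)
Definition marginal_rate q i : R :=
  \sum_j X i j * q j 0 + dv i 0 + X i i * q i 0.

(** An upper bound of the one-sided directional derivative of [h_i] at [q]
towards the strategy [t]: the quadratic part is linearized, but the convex cost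
is replaced by its chord, so that no derivative of it is needed. *)
Definition first_order_gap q i t : R :=
  node_cost (f i) t - node_cost (f i) (q i 0)
  + (t - q i 0) * marginal_rate q i.

Lemma game_cost_deviate q i t :
  game_cost X dv f i (deviate q i t) - game_cost X dv f i q =
  first_order_gap q i t + X i i * (t - q i 0) ^+ 2.
Proof.
rewrite /game_cost /first_order_gap /marginal_rate mxE eqxx.
rewrite (bigD1 i)//= mxE eqxx [in RHS](bigD1 i)//=.
rewrite [in LHS](bigD1 i (P := predT))//=.
rewrite (eq_bigr (fun j => X i j * q j 0)); last first.
  by move=> j /negPf ji; rewrite mxE ji.
by ring.
Qed.

Hypothesis X_sym : X^T = X.

(** The exact second-order expansion of [W] at [q], with the nonsmooth costs kept
as increments. *)
Lemma potentialB p q :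
  potential X dv f p - potential X dv f q =
  \sum_i first_order_gap q i (p i 0)
  + 2^-1 * (\sum_i X i i * (p i 0 - q i 0) ^+ 2
            + ((p - q)^T *m X *m (p - q)) 0 0).
Proof.
have [d dE] : {d | d = p - q} by exists (p - q).
rewrite -dE; have -> : p = q + d by rewrite dE addrC subrK.
have addE (A B : 'M[R]_1) : (A + B) 0 0 = A 0 0 + B 0 0 by rewrite mxE.
have dotE (u v : 'cV[R]_n) : (u^T *m v) 0 0 = \sum_i u i 0 * v i 0.
  by rewrite mxE; apply: eq_bigr => i _; rewrite mxE.
(* Symmetry of X merges the two cross terms. *)
have cross : ((q + d)^T *m X *m (q + d)) 0 0 =
    (q^T *m X *m q) 0 0 + 2 * (d^T *m (X *m q)) 0 0 + (d^T *m X *m d) 0 0.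
  have qd : (q^T *m X *m d) 0 0 = (d^T *m (X *m q)) 0 0.
    have -> : d^T *m (X *m q) = (q^T *m X *m d)^T.
      by rewrite !trmx_mul trmxK X_sym.
    by rewrite [RHS]mxE.
  rewrite [(q + d)^T]raddfD/= !mulmxDl !mulmxDr !addE qd -[d^T *m X *m q]mulmxA.
  by ring.
rewrite /potential cross [(q + d)^T]raddfD/= mulmxDl.
have gaps : \sum_i first_order_gap q i ((q + d) i 0) =
    \sum_i (node_cost (f i) ((q + d) i 0) - node_cost (f i) (q i 0)
            + X i i * q i 0 * d i 0)
    + (d^T *m (X *m q)) 0 0 + (d^T *m dv) 0 0.
  rewrite !dotE -!big_split/=; apply: eq_bigr => i _.
  by rewrite /first_order_gap /marginal_rate !mxE; ring.
rewrite gaps addE.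
have -> : \sum_i (node_cost (f i) ((q + d) i 0)
                  + 2^-1 * X i i * (q + d) i 0 ^+ 2) =
    \sum_i (node_cost (f i) (q i 0) + 2^-1 * X i i * q i 0 ^+ 2)
    + \sum_i (node_cost (f i) ((q + d) i 0) - node_cost (f i) (q i 0)
            + X i i * q i 0 * d i 0)
    + 2^-1 * \sum_i X i i * ((q + d) i 0 - q i 0) ^+ 2.
  rewrite mulr_sumr -!big_split/=; apply: eq_bigr => i _.
  by rewrite !mxE; field.
by field.
Qed.

(** In the expansion of [W], the two halves of [X_ii (t - q_i)^2], one from the
extra diagonal term and one from the quadratic form, add up to the second-order
term of [h_i]. *)
Lemma potential_deviate q i t :
  potential X dv f (deviate q i t) - potential X dv f q =
  game_cost X dv f i (deviate q i t) - game_cost X dv f i q.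
Proof.
rewrite potentialB game_cost_deviate.
have dev j : j != i -> deviate q i t j 0 = q j 0 by rewrite mxE => /negPf ->.
have devi : deviate q i t i 0 = t by rewrite mxE eqxx.
have -> : deviate q i t - q = (t - q i 0) *: delta_mx i 0.
  apply/colP => j; rewrite !mxE andbT.
  by have [->|_] := eqVneq j i; rewrite ?mulr1// mulr0 subrr.
rewrite (bigD1 i)//= big1 => [|j ji]; last first.
  by rewrite /first_order_gap dev// !subrr mul0r addr0.
rewrite (bigD1 i)//= big1 => [|j ji]; last by rewrite dev// subrr expr0n mulr0.
rewrite devi [(_ *: _)^T]linearZ/= trmx_delta -!scalemxAl -scalemxAr.
by rewrite -rowE -colE !mxE; field.
Qed.

(** This is the limit [t -> 0], made effective by one well-chosen [t]. *)
Lemma ge0_of_affine_ge0 (a b : R) :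
  (forall t, 0 < t -> t <= 1 -> 0 <= a + t * b) -> 0 <= a.
Proof.
move=> ab; rewrite leNgt; apply/negP => a0.
(* At t := - a / (|b| + 1 - a) one has t b < - a when a < 0. *)
have D0 : 0 < `|b| + 1 - a by have := normr_ge0 b; lra.
have := ab (- a / (`|b| + 1 - a)) _ _.
rewrite divr_gt0 ?oppr_gt0// ler_pdivrMr// mul1r.
move=> /(_ isT); have := normr_ge0 b => nb.
have -> : - a <= `|b| + 1 - a by lra.
move=> /(_ isT); rewrite mulrAC -(pmulr_lge0 _ D0) mulrDl divfK ?gt_eqF//.
have : `|b| * (-a) >= b * (-a) by rewrite ler_wpM2r ?ler_norm// oppr_ge0 ltW.
by nra.
Qed.

Variable Omega : 'I_n -> set R.
Hypothesis node_cost_convex : forall i a b t, Omega i a -> Omega i b ->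
  0 <= t <= 1 ->
  Omega i (a + t * (b - a)) /\
  node_cost (f i) (a + t * (b - a)) <=
    node_cost (f i) a + t * (node_cost (f i) b - node_cost (f i) a).

(** For the deviation [q_i + t (b - q_i)], convexity bounds the cost increment by
[t] times the chord, so the Nash inequality divided by [t] is affine in [t] with
constant term the gap. *)
Lemma nash_first_order q i b :
  nash_equilibrium Omega (game_cost X dv f) q -> Omega i b ->
  0 <= first_order_gap q i b.
Proof.
move=> [Oq nq] Ob; apply: (@ge0_of_affine_ge0 _ (X i i * (b - q i 0) ^+ 2)).
move=> t t0 t1.
have t01 : 0 <= t <= 1 by rewrite ltW.
have [Ot cvx] := node_cost_convex (Oq i) Ob t01.
have := nq i _ Ot; rewrite -subr_ge0 game_cost_deviate /first_order_gap => dev.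
rewrite -(pmulr_rge0 _ t0); apply: le_trans dev _.
by lra.
Qed.

Hypothesis X_psd : forall d : 'cV[R]_n, 0 <= (d^T *m X *m d) 0 0.

(** Strong convexity of the extra diagonal term gives a quadratic growth of [W]
away from an equilibrium; it is what makes the minimizer unique even if the
costs are affine. *)
Lemma nash_potential_growth p q :
  nash_equilibrium Omega (game_cost X dv f) q -> profiles Omega p ->
  potential X dv f q + 2^-1 * \sum_i X i i * (p i 0 - q i 0) ^+ 2
    <= potential X dv f p.
Proof.
move=> nq Op; rewrite -lerBrDl potentialB mulrDr addrCA lerDl addr_ge0//.
  by apply: sumr_ge0 => i _; exact: nash_first_order.
by rewrite mulr_ge0 ?invr_ge0.
Qed.

Hypothesis X_diag_gt0 : forall i, 0 < X i i.

Lemma nash_unique_minimizer q :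
  nash_equilibrium Omega (game_cost X dv f) q ->
  unique_minimizer (profiles Omega) (potential X dv f) q.
Proof.
move=> nq; have Oq := nq.1.
have sq_ge0 p i : 0 <= X i i * (p i 0 - q i 0) ^+ 2.
  by rewrite mulr_ge0 ?sqr_ge0// ltW.
split.
  split=> // p Op; apply: le_trans (nash_potential_growth nq Op).
  by rewrite lerDl mulr_ge0 ?invr_ge0//; apply: sumr_ge0.
move=> p [Op minp]; apply/colP => i; apply/eqP; rewrite -subr_eq0 -sqrf_eq0.
have := le_trans (nash_potential_growth nq Op) (minp _ Oq).
rewrite gerDl pmulr_rle0 ?invr_gt0// => s0.
have /eqP : \sum_i X i i * (p i 0 - q i 0) ^+ 2 = 0.
  by apply/eqP; rewrite eq_le s0 sumr_ge0.
rewrite psumr_eq0// => /allP/(_ i (mem_index_enum _)).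
by rewrite /= mulf_eq0 gt_eqF.
Qed.

Lemma minimizer_nash q :
  is_minimizer (profiles Omega) (potential X dv f) q ->
  nash_equilibrium Omega (game_cost X dv f) q.
Proof.
move=> [Oq minq]; split=> // i t Ot.
rewrite -subr_ge0 -potential_deviate subr_ge0; apply: minq => j.
by rewrite mxE; case: eqVneq => [->|].
Qed.

End PotentialGame.

(** * Existence and uniqueness of the equilibrium *)

(** The costs may be ill-behaved outside the strategy intervals, so the extreme
value theorem is applied to the globally continuous function obtained from the
extensions [c], which agrees with [W] on the box. *)
Lemma potential_minimizer_exists {R : realType} {n : nat} (X : 'M[R]_n)
    (dv : 'cV[R]_n) (f : 'I_n -> R -> R) (qmin qmax : 'I_n -> R)
    (c : 'I_n -> R -> R) :
  (forall i, qmin i <= qmax i) -> (forall i, continuous (c i)) ->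
  (forall i, {in `[qmin i, qmax i], node_cost (f i) =1 c i}) ->
  exists q, is_minimizer (profiles (strategy_interval qmin qmax))
              (potential X dv f) q.
Proof.
move=> ordered c_cont fc.
pose W (v : 'rV[R]_n) : R :=
  \sum_i (c i (v 0 i) + 2^-1 * X i i * v 0 i ^+ 2)
  + 2^-1 * (\sum_j (\sum_i v 0 i * X i j) * v 0 j) + \sum_i v 0 i * dv i 0.
pose box :=
  [set v : 'rV[R]_n | forall i, `[qmin i, qmax i]%classic (v 0 i)]%classic.
have WE (v : 'rV[R]_n) : box v -> potential X dv f v^T = W v.
  move=> bv; rewrite /potential /W trmxK; congr (_ + _ * _ + _);
    last by rewrite mxE.
    by apply: eq_bigr => i _; rewrite mxE fc//; exact: bv.
  by rewrite mxE; apply: eq_bigr => j _; rewrite mxE [v^T _ _]mxE.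
have W_cont : continuous W.
  have cD (F G : 'rV[R]_n -> R) :
      continuous F -> continuous G -> continuous (fun v => F v + G v).
    by move=> cF cG v; exact: (@cvgD _ _ _ (nbhs v) _ F G _ _ (cF v) (cG v)).
  have cM (F G : 'rV[R]_n -> R) :
      continuous F -> continuous G -> continuous (fun v => F v * G v).
    by move=> cF cG v; exact: (@cvgM _ _ (nbhs v) _ F G _ _ (cF v) (cG v)).
  have cK (k : R) : continuous (fun v : 'rV[R]_n => k) by exact: cst_continuous.
  have cS (F : 'I_n -> 'rV[R]_n -> R) : (forall i, continuous (F i)) ->
      continuous (fun v => \sum_i F i v).
    move=> cF; apply: continuous_big => // v.
    exact: pseudometric_normed_Zmodule.add_continuous.
  have cX i : continuous (fun v : 'rV[R]_n => v 0 i) by exact: coord_continuous.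
  have cC i : continuous (fun v : 'rV[R]_n => c i (v 0 i)).
    by move=> v; apply: continuous_comp; [exact: cX|exact: c_cont].
  apply: (cD); first apply: (cD).
  - by apply: (cS) => i; apply: (cD) => //; apply: (cM) => //; apply: (cM).
  - apply: (cM) => //; apply: (cS) => j; apply: (cM) => //.
    by apply: (cS) => i; apply: (cM).
  - by apply: (cS) => i; apply: (cM).
have [|||v bv minv] := @EVT_min_rV _ _ W box.
- by exists (\row_i qmin i) => i; rewrite mxE /= in_itv/= lexx ordered.
- apply: (@rV_compact R n (fun i => `[qmin i, qmax i]%classic)) => i.
  exact: segment_compact.
- exact: continuous_subspaceT.
rewrite inE in bv; exists v^T; split=> [i|q Oq]; first by rewrite mxE; exact: bv.
have bq : box q^T by move=> i; rewrite mxE; exact: Oq.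
by rewrite -[q]trmxK !WE//; apply: minv; rewrite inE.
Qed.

Lemma subgradient_convex {R : realType} (c s : R -> R) (a b t : R) :
  (forall u v, c u + s u * (v - u) <= c v) -> 0 <= t <= 1 ->
  c (a + t * (b - a)) <= c a + t * (c b - c a).
Proof.
move=> cs /andP[t0 t1]; set m := a + t * (b - a).
have : (1 - t) * (c m + s m * (a - m)) <= (1 - t) * c a.
  by rewrite ler_wpM2l// subr_ge0.
have : t * (c m + s m * (b - m)) <= t * c b by rewrite ler_wpM2l.
rewrite -subr_ge0 => hb; rewrite -subr_ge0 => ha.
rewrite -subr_ge0; apply: le_trans (addr_ge0 ha hb) _.
by rewrite le_eqVlt; apply/orP; left; apply/eqP; rewrite /m; ring.
Qed.

Theorem theorem3 (R : realType) (n : nat)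
    (L : {set {set 'I_n.+1}}) (x : {set 'I_n.+1} -> R) (dv : 'cV[R]_n)
    (delta qmin qmax : 'I_n -> R) (f : 'I_n -> R -> R)
    (Ltree : is_tree L)
    (x_gt0 : forall l, l \in L -> 0 < x l)
    (delta_ge0 : forall i, 0 <= delta i)
    (f_dead : forall i u, - (delta i / 2) <= u <= delta i / 2 -> f i u = 0)
    (Omega_neq0 : forall i, qmin i <= qmax i)
    (f_inv : forall i q y, strategy_interval qmin qmax i q ->
       y != 0 -> Num.min 0 q <= y <= Num.max 0 q -> exists u, f i u = y)
    (f_nonincr : forall i u v, u <= v -> f i v <= f i u)
    (f_decr : forall i u v,
       (u < - (delta i / 2)) || (delta i / 2 < u) ->
       (v < - (delta i / 2)) || (delta i / 2 < v) ->
       u < v -> f i v < f i u)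
    (f_diff : forall i u,
       (u < - (delta i / 2)) || (delta i / 2 < u) -> derivable (f i) u 1) :
  let Omega := strategy_interval qmin qmax in
  let h := game_cost (reactance_mx L x) dv f in
  let W := potential (reactance_mx L x) dv f in
  (exists! qa : 'cV[R]_n, nash_equilibrium Omega h qa) /\
  (forall qa : 'cV[R]_n, profiles Omega qa ->
     (nash_equilibrium Omega h qa <-> unique_minimizer (profiles Omega) W qa)).
Proof.
move=> Omega h W.
have f0 i : f i 0 = 0 by apply: f_dead; rewrite oppr_le0 divr_ge0// delta_ge0.
have /boolp.choice[c cP] i : exists c : R -> R,
    [/\ {in `[qmin i, qmax i], node_cost (f i) =1 c}, continuous c &
       forall a b t, 0 <= t <= 1 ->
         c (a + t * (b - a)) <= c a + t * (c b - c a)].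
  have [|c [s [fc cs cc]]] :=
    node_cost_extension (Omega_neq0 i) (f_nonincr i) (f0 i).
  - move=> q y qi; apply: (f_inv i q).
    by rewrite /strategy_interval /= in_itv.
  - by exists c; split=> // a b t; exact: (subgradient_convex _ _ cs).
have node_cost_convex i a b t : Omega i a -> Omega i b -> 0 <= t <= 1 ->
    Omega i (a + t * (b - a)) /\
    node_cost (f i) (a + t * (b - a)) <=
      node_cost (f i) a + t * (node_cost (f i) b - node_cost (f i) a).
  have [fc _ cvx] := cP i.
  move=> Oa Ob t01; have Om : Omega i (a + t * (b - a)).
    move: Oa Ob t01; rewrite /Omega /strategy_interval /= !in_itv/=.
    by move=> /andP[? ?] /andP[? ?] /andP[? ?]; apply/andP; split; nra.
  by split=> //; rewrite !fc//; exact: cvx.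
have [_ conn _] := Ltree.
have X_sym := reactance_mx_sym L x.
have X_psd := reactance_mx_psd x_gt0.
have X_diag i := reactance_mx_diag_gt0 x_gt0 (conn ord0 (lift ord0 i)).
have nash_min q : nash_equilibrium Omega h q ->
    unique_minimizer (profiles Omega) W q.
  exact: nash_unique_minimizer.
have min_nash q : is_minimizer (profiles Omega) W q ->
    nash_equilibrium Omega h q.
  exact: minimizer_nash.
have [q minq] : exists q, is_minimizer (profiles Omega) W q.
  by apply: (@potential_minimizer_exists _ _ _ _ _ _ _ c) => // i;
    have [] := cP i.
split.
  exists q; split=> [|p /nash_min[minp _]]; first exact: min_nash.
  by rewrite ((nash_min q (min_nash q minq)).2 p minp).
by move=> qa _; split=> [/nash_min|[/min_nash]].
Qed.
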